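(* Every integral completely positive $2\times 2$ matrix has an integral cp-factorization. That is, if $A\in\mathcal{CP}^2$ has all entries in $\mathbb{Z}$, then there exist $m\in\mathbb{N}$ and vectors $x_1,\dots,x_m\in\mathbb{Z}^2_{\ge 0}$ such that $A=\sum_{i=1}^m x_ix_i^{\sf T}$.
   Context: The cone of completely positive $2\times2$ matrices is $$\mathcal{CP}^2=\Big\{\sum_{i=1}^m\alpha_i x_ix_i^{\sf T}: m\in\mathbb{N},\ \alpha_i\in\mathbb{R}_{\ge 0},\ x_i\in\mathbb{R}^2_{\ge 0}\Big\}.$$ *)

(* Defs.v *)
From HB Require Import structures.
From mathcomp Require Import all_boot all_order all_algebra.
From mathcomp Require Import reals.

Set Implicit Arguments.
Unset Strict Implicit.
Unset Printing Implicit Defensive.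

Import Order.TTheory GRing.Theory Num.Theory.
Local Open Scope ring_scope.

Definition completely_positive (R : realType) (n : nat) (A : 'M[R]_n) : Prop :=
  exists (m : nat) (alpha : 'I_m -> R) (x : 'I_m -> 'cV[R]_n),
    [/\ forall i, 0 <= alpha i,
        forall i k, 0 <= x i k 0
      & A = \sum_(i < m) alpha i *: (x i *m (x i)^T)].

(* Main.v *)
Require Import Defs.
From HB Require Import structures.
From mathcomp Require Import all_boot all_order all_algebra.
From mathcomp Require Import reals.
From mathcomp Require Import zify ring lra.

Set Implicit Arguments.
Unset Strict Implicit.
Unset Printing Implicit Defensive.

Import Order.TTheory GRing.Theory Num.Theory.
Local Open Scope ring_scope.

(** Write [a, b, c] for the entries of [A]; they are natural numbers with
    [b ^ 2 <= a c].  If [b <= a] and [b <= c], then [A] is [b] times the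
    all-ones matrix plus a nonnegative diagonal matrix.  If [a < b], the shear
    sending [(u, v)] to [(u, v - u)] turns [(a, b, c)] into
    [(a, b - a, a + c - 2 b)], which has the same determinant and a smaller
    off-diagonal entry; the inverse shear [(u, v) |-> (u, u + v)] preserves
    nonnegative integer vectors.  The case [c < b] is symmetric. *)

(** The entries of the sum of [p *m p^T] over the pairs [p] of [s], kept in [nat] so that the
    descent is pure arithmetic. *)
Definition gram_nat (s : seq (nat * nat)) (a b c : nat) : Prop :=
  [/\ (\sum_(p <- s) p.1 * p.1 = a)%N,
      (\sum_(p <- s) p.1 * p.2 = b)%N
    & (\sum_(p <- s) p.2 * p.2 = c)%N].

Lemma gram_nat_swap s a b c : gram_nat s a b c ->
  gram_nat [seq (p.2, p.1) | p <- s] c b a.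
Proof.
case=> <- <- <-; split; rewrite big_map //=.
by apply: eq_bigr => p _; rewrite mulnC.
Qed.

Lemma gram_nat_shear s a b c : gram_nat s a b c ->
  gram_nat [seq (p.1, p.1 + p.2)%N | p <- s] a (a + b) (a + b.*2 + c).
Proof.
case=> <- <- <-; split; rewrite big_map //= -?mul2n ?big_distrr -!big_split /=;
  by apply: eq_bigr => p _; ring.
Qed.

Lemma gram_nat_diag_dominant a b c : (b <= a)%N -> (b <= c)%N ->
  gram_nat (nseq b (1, 1) ++ nseq (a - b) (1, 0) ++ nseq (c - b) (0, 1))%N a b c.
Proof.
move=> ba bc; split; rewrite !big_cat !big_nseq !iter_addn_0 /=; lia.
Qed.

Lemma gram_nat_exists a b c : (b * b <= a * c)%N -> exists s, gram_nat s a b c.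
Proof.
have [n] := ubnP b; elim: n a b c => // n IH.
(* Stated for all [a] and [c], so that swapping them also settles the case [c < b]. *)
have shear a b c : (b < n.+1)%N -> (b * b <= a * c)%N -> (a < b)%N ->
    exists s, gram_nat s a b c.
  move=> bn bac ab; have [d Ed] : exists d, b = (a + d)%N.
    by exists (b - a)%N; lia.
  (* If [a = 0], then [b * b <= 0], against [a < b]. Positivity of [a] makes [d < b], so the descent
     is strict. *)
  have [a0 d0] : (0 < a /\ 0 < d)%N by nia.
  (* Cancel [a] in [a * (a + 2 d) <= (a + d)^2 <= a * c]. *)
  have dc : (a + d.*2 <= c)%N by rewrite -(leq_pmul2l a0); nia.
  have [e Ee] : exists e, c = (a + d.*2 + e)%N by exists (c - (a + d.*2))%N; lia.
  have [||s /gram_nat_shear H] := IH a d e; [lia|nia|].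
  by eexists; rewrite Ed Ee; exact: H.
move=> a b c bn bac; have [ba|ab] := leqP b a; last exact: shear.
have [bc|cb] := leqP b c; first by eexists; exact: gram_nat_diag_dominant.
have [|s /gram_nat_swap H] := shear c b a bn _ cb; first by rewrite mulnC.
by eexists; exact: H.
Qed.

Lemma quad_form_discr (R : realFieldType) (a b c : R) : 0 <= c ->
  (forall s t, 0 <= a * s ^+ 2 + b * s * t *+ 2 + c * t ^+ 2) -> b * b <= a * c.
Proof.
rewrite le_eqVlt => /predU1P[<- Q|c0 Q].
  (* For [c = 0] the form takes the value [- (a + 2) * b^2] at [(b, - (a + 1))] and [a] at [(1, 0)],
     which forces [b = 0]. *)
  have Qb := Q b (- (a + 1)); have Q1 := Q 1 0.
  have a0 : 0 <= a by move: Q1; rewrite expr1n; lra.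
  have : 0 <= a * (b * b) by rewrite mulr_ge0 // -expr2 sqr_ge0.
  rewrite mulr0; nra.
have := Q c (- b).
have -> : a * c ^+ 2 + b * c * - b *+ 2 + c * (- b) ^+ 2 = c * (a * c - b * b).
  by ring.
by rewrite pmulr_rge0 // subr_ge0.
Qed.

(** The determinant inequality is not visibly additive, but nonnegativity of the quadratic form is:
    it passes through the sum and yields the inequality at the end. *)
Lemma completely_positive2 (R : realType) (A : 'M[R]_2) :
  completely_positive A ->
  [/\ forall i j, 0 <= A i j, A 1 0 = A 0 1 & A 0 1 * A 0 1 <= A 0 0 * A 1 1].
Proof.
case=> m [al [x [al0 x0 ->]]]; set S := \sum_(i < m) _.
have [S0 Ssym SQ] : [/\ forall i j, 0 <= S i j, S 1 0 = S 0 1 & forall s t,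
    0 <= S 0 0 * s ^+ 2 + S 0 1 * s * t *+ 2 + S 1 1 * t ^+ 2].
  apply: (big_ind (fun M : 'M[R]_2 => [/\ forall i j, 0 <= M i j,
    M 1 0 = M 0 1 & forall s t,
    0 <= M 0 0 * s ^+ 2 + M 0 1 * s * t *+ 2 + M 1 1 * t ^+ 2])).
  - by split=> [i j||s t]; rewrite !mxE // !mul0r mul0rn !addr0.
  - move=> M N [M0 Ms MQ] [N0 Ns NQ]; split=> [i j||s t]; rewrite !mxE.
    + exact: addr_ge0.
    + by rewrite Ms Ns.
    + by have := addr_ge0 (MQ s t) (NQ s t); congr (0 <= _); ring.
  - move=> k _; split=> [i j||s t]; rewrite !mxE !big_ord1 !mxE.
    + by rewrite !mulr_ge0.
    + by congr (_ * _); rewrite mulrC.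
    (* The form of a rank-one term is [al k] times the square of a linear form. *)
    + have := mulr_ge0 (al0 k) (sqr_ge0 (x k 0 0 * s + x k 1 0 * t)).
      by congr (0 <= _); ring.
by split=> //; apply: quad_form_discr.
Qed.

Theorem mainTheorem2 (R : realType) (A : 'M[R]_2)
    (A_cp : completely_positive A)
    (A_int : forall i j, A i j \is a Num.int) :
  exists (m : nat) (x : 'I_m -> 'cV[R]_2),
    [/\ forall i k, x i k 0 \is a Num.int,
        forall i k, 0 <= x i k 0
      & A = \sum_(i < m) x i *m (x i)^T].
Proof.
have [A0 Asym AD] := completely_positive2 A_cp.
have Anat i j : exists n, A i j = n%:R.
  by apply/natrP; rewrite natrEint A_int A0.
have [[[a Ea] [b Eb]] [c Ec]] := (Anat 0 0, Anat 0 1, Anat 1 1).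
have [s [sa sb sc]] : exists s, gram_nat s a b c.
  by apply: gram_nat_exists; move: AD; rewrite Ea Eb Ec -!natrM ler_nat.
pose v (p : nat * nat) : 'cV[R]_2 :=
  \col_k (if k == ord0 then p.1 else p.2)%:R.
(* The default [(0, 0)] is never reached, since [i < size s]. *)
exists (size s), (fun i => v (nth (0, 0)%N s i)); split.
- by move=> i k; rewrite mxE.
- by move=> i k; rewrite mxE.
- have -> : \sum_(i < size s) v (nth (0, 0)%N s i) *m (v (nth (0, 0)%N s i))^T
      = \sum_(p <- s) v p *m (v p)^T.
    by rewrite (big_nth (0, 0)%N) big_mkord.
  have vE i j : (\sum_(p <- s) v p *m (v p)^T) i j =
      (\sum_(p <- s) (if i == ord0 then p.1 else p.2) *
                     (if j == ord0 then p.1 else p.2))%:R.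
    rewrite summxE natr_sum; apply: eq_bigr => p _.
    by rewrite mxE big_ord1 !mxE natrM.
  have case2 (i : 'I_2) : i = 0 \/ i = 1.
    by case: i => [[|[|//]] ?]; [left|right]; apply: val_inj.
  apply/matrixP => i j; rewrite vE.
  case: (case2 i) => ->; case: (case2 j) => -> /=.
  + by rewrite Ea -sa.
  + by rewrite Eb -sb.
  + by rewrite Asym Eb -sb; congr _%:R; apply: eq_bigr => p _; rewrite mulnC.
  + by rewrite Ec -sc.
Qed.
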